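(* Let $\mathscr{I}$ be the class of irreducible representations of $G=\mathrm{SA}(2,\mathbb{Z})$ that are induced from an irreducible unitary representation of $\mathrm{SL}(2,\mathbb{Z})$. Then $\inf_{\pi\in\mathscr{I}}\kappa_G(\pi)>0$.
   Context: $\mathrm{SA}(2,\mathbb{Z})=\mathrm{SL}(2,\mathbb{Z})\ltimes\mathbb{Z}^2$, with $\mathrm{SL}(2,\mathbb{Z})$ embedded as the subgroup of elements with zero translation part. Representations are unitary. For a unitary representation $(\pi,\mathcal{H})$ of a countable group $G$ and a finite set $S\subset G$, $\kappa_G(S,\pi)=\inf\{\sup_{g\in S}\|\pi(g)\xi-\xi\| : \xi\in\mathcal{H},\ \|\xi\|=1\}$, and $\kappa_G(\pi)=\inf_S\kappa_G(S,\pi)$, the infimum being over all finite sets $S$ generating $G$. *)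

(* Defs.v *)
From HB Require Import structures.
From mathcomp Require Import all_boot all_order all_algebra all_fingroup.
From mathcomp Require Import all_classical all_reals all_analysis.
From mathcomp Require Import complex.

Set Implicit Arguments.
Unset Strict Implicit.
Unset Printing Implicit Defensive.

Import Order.TTheory GRing.Theory Num.Theory.
Import numFieldNormedType.Exports.

Local Open Scope classical_set_scope.
Local Open Scope ring_scope.

(* The inner product is linear in its first argument and conjugate-linear in
   its second one. *)
Record hilbertSpace (R : realType) := HilbertSpace {
  hilbert_mod :> completeNormedModType R[i];
  inner : {dot hilbert_mod for Num.conj};
  inner_norm : forall x : hilbert_mod, `|x| ^+ 2 = inner x x }.

(* The norm of a normed module over R[i] takes its values in R[i], where it is
   a nonnegative real; [rnorm] is that value as an element of R. *)
Definition rnorm (R : realType) (H : hilbertSpace R) (x : H) : R :=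
  complex.Re `|x|.

Record unitaryRep (R : realType) (G : groupType) := UnitaryRep {
  rep_space : hilbertSpace R;
  rep_op :> G -> {linear rep_space -> rep_space};
  rep_op1 : forall x, rep_op 1%g x = x;
  rep_opM : forall g h x, rep_op (g * h)%g x = rep_op g (rep_op h x);
  rep_op_inner : forall g x y,
    inner rep_space (rep_op g x) (rep_op g y) = inner rep_space x y }.

Section Representations.
Variables (R : realType) (G : groupType).
Implicit Types (pi : unitaryRep R G) (S : set G).

Definition linear_subspace (H : hilbertSpace R) (V : set H) : Prop :=
  V 0 /\ forall (a : R[i]) (u v : H), V u -> V v -> V (a *: u + v).

Definition rep_invariant pi (V : set (rep_space pi)) : Prop :=
  forall g v, V v -> V (pi g v).

Definition irreducible_rep pi : Prop :=
  (exists x : rep_space pi, x != 0) /\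
  forall V : set (rep_space pi),
    linear_subspace V -> closed V -> rep_invariant V ->
    V = [set 0] \/ V = [set: rep_space pi].

Definition group_generated_by S : Prop :=
  forall P : {pred G}, group_closed P ->
    (forall g, S g -> g \in P) -> forall g, g \in P.

Definition kappa_set S pi : \bar R :=
  ereal_inf [set ereal_sup [set (rnorm (pi g xi - xi))%:E | g in S]
            | xi in [set xi : rep_space pi | rnorm xi = 1]].

Definition kappa pi : \bar R :=
  ereal_inf [set kappa_set S pi
            | S in [set S | finite_set S /\ group_generated_by S]].

End Representations.

(* The representation of G induced from the representation sigma of a subgroup
   K, given by the inclusion iota : K -> G. Its space consists of the functions
   f : G -> rep_space sigma with f (g k) = sigma(k)^-1 (f g) for which the
   function |f|^2, which is constant on each coset g K, is summable over the
   set of these cosets, and G acts by left translation. *)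
Section Induction.
Variables (R : realType) (K G : groupType) (iota : {multiplicative K -> G}).
Variable sigma : unitaryRep R K.
Implicit Types f : G -> rep_space sigma.

Definition coset_of_image (g : G) : set G :=
  [set (g * iota k)%g | k in [set: K]].

Definition ind_equivariant f : Prop :=
  forall g k, f (g * iota k)%g = sigma k^-1%g (f g).

Definition ind_sqnorm f : \bar R :=
  \esum_(C in range coset_of_image) (rnorm (f (xget 1%g C)) ^+ 2)%:E.

(* pi is unitarily equivalent to the representation induced by sigma: the
   equivalence sends x to the function g |-> U g x. *)
Definition is_induced_from (pi : unitaryRep R G) : Prop :=
  exists U : G -> {linear rep_space pi -> rep_space sigma},
  [/\ forall x, ind_equivariant (U^~ x),
      forall x, ind_sqnorm (U^~ x) = (rnorm x ^+ 2)%:E,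
      forall f, ind_equivariant f -> (ind_sqnorm f < +oo)%E ->
        exists x, f = U^~ x
    & forall h x g, U g (pi h x) = U (h^-1 * g)%g x].

End Induction.

Record SL2Z := MkSL2Z { SL2Z_mx :> 'M[int]_2; SL2Z_det : \det SL2Z_mx == 1 }.

HB.instance Definition _ := [isSub for SL2Z_mx].
HB.instance Definition _ := [Choice of SL2Z by <:].

Fact SL2Z_one_subproof : \det (1%:M : 'M[int]_2) == 1.
Proof. by rewrite det1. Qed.

Fact SL2Z_mul_subproof (A B : SL2Z) : \det (A *m B) == 1.
Proof. by rewrite det_mulmx (eqP (SL2Z_det A)) (eqP (SL2Z_det B)) mulr1. Qed.

Fact SL2Z_adjK (A : SL2Z) : A *m \adj A = 1%:M.
Proof. by rewrite mul_mx_adj (eqP (SL2Z_det A)). Qed.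

Fact SL2Z_inv_subproof (A : SL2Z) : \det (\adj A) == 1.
Proof.
have := congr1 determinant (SL2Z_adjK A).
by rewrite det_mulmx det1 (eqP (SL2Z_det A)) mul1r => ->.
Qed.

Definition SL2Z_one : SL2Z := MkSL2Z SL2Z_one_subproof.
Definition SL2Z_mul (A B : SL2Z) : SL2Z := MkSL2Z (SL2Z_mul_subproof A B).
Definition SL2Z_inv (A : SL2Z) : SL2Z := MkSL2Z (SL2Z_inv_subproof A).

Fact SL2Z_mulA : associative SL2Z_mul.
Proof. by move=> A B C; apply: val_inj; rewrite /= mulmxA. Qed.

Fact SL2Z_mul1 : left_id SL2Z_one SL2Z_mul.
Proof. by move=> A; apply: val_inj; rewrite /= mul1mx. Qed.

Fact SL2Z_mulr1 : right_id SL2Z_one SL2Z_mul.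
Proof. by move=> A; apply: val_inj; rewrite /= mulmx1. Qed.

Fact SL2Z_mulV : left_inverse SL2Z_one SL2Z_inv SL2Z_mul.
Proof.
by move=> A; apply: val_inj; rewrite /= mul_adj_mx (eqP (SL2Z_det A)).
Qed.

Fact SL2Z_mulrV : right_inverse SL2Z_one SL2Z_inv SL2Z_mul.
Proof. by move=> A; apply: val_inj; rewrite /= SL2Z_adjK. Qed.

HB.instance Definition _ := isGroup.Build SL2Z
  SL2Z_mulA SL2Z_mul1 SL2Z_mulr1 SL2Z_mulV SL2Z_mulrV.

(* The pair (A, v) is the affine map x |-> A x + v of Z^2. *)
Record SA2Z := MkSA2Z { SA2Z_lin : SL2Z; SA2Z_trans : 'cV[int]_2 }.

Definition SA2Z_pair (g : SA2Z) := (SA2Z_lin g, SA2Z_trans g).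
Definition SA2Z_of_pair (p : SL2Z * 'cV[int]_2) := MkSA2Z p.1 p.2.

Fact SA2Z_pairK : cancel SA2Z_pair SA2Z_of_pair. Proof. by case. Qed.

HB.instance Definition _ := Equality.copy SA2Z (can_type SA2Z_pairK).
HB.instance Definition _ := Choice.copy SA2Z (can_type SA2Z_pairK).

Definition SA2Z_one : SA2Z := MkSA2Z 1%g 0.
Definition SA2Z_mul (g h : SA2Z) : SA2Z :=
  MkSA2Z (SA2Z_lin g * SA2Z_lin h)%g
         (SA2Z_trans g + SA2Z_lin g *m SA2Z_trans h).
Definition SA2Z_inv (g : SA2Z) : SA2Z :=
  MkSA2Z (SA2Z_lin g)^-1%g (- (SL2Z_mx (SA2Z_lin g)^-1%g *m SA2Z_trans g)).

Fact SA2Z_mulA : associative SA2Z_mul.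
Proof.
move=> [A u] [B v] [C w]; rewrite /SA2Z_mul /= mulgA; congr MkSA2Z.
by rewrite mulmxDr mulmxA addrA.
Qed.

Fact SA2Z_mul1 : left_id SA2Z_one SA2Z_mul.
Proof. by move=> [A u]; rewrite /SA2Z_mul /= mul1g mul1mx add0r. Qed.

Fact SA2Z_mulr1 : right_id SA2Z_one SA2Z_mul.
Proof. by move=> [A u]; rewrite /SA2Z_mul /= mulg1 mulmx0 addr0. Qed.

Fact SA2Z_mulV : left_inverse SA2Z_one SA2Z_inv SA2Z_mul.
Proof.
by move=> [A u]; rewrite /SA2Z_mul /SA2Z_inv /= mulVg addNr.
Qed.

Fact SA2Z_mulrV : right_inverse SA2Z_one SA2Z_inv SA2Z_mul.
Proof.
move=> [A u]; rewrite /SA2Z_mul /SA2Z_inv /= mulgV mulmxN mulmxA.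
by rewrite SL2Z_adjK mul1mx subrr.
Qed.

HB.instance Definition _ := isGroup.Build SA2Z
  SA2Z_mulA SA2Z_mul1 SA2Z_mulr1 SA2Z_mulV SA2Z_mulrV.

Definition SL2Z_in_SA2Z (A : SL2Z) : SA2Z := MkSA2Z A 0.

Fact SL2Z_in_SA2Z_morph : {morph SL2Z_in_SA2Z : A B / (A * B)%g}.
Proof. by move=> A B; rewrite [RHS]/(SA2Z_mul _ _) /SA2Z_mul /= mulmx0 addr0. Qed.

HB.instance Definition _ :=
  isMultiplicative.Build SL2Z SA2Z SL2Z_in_SA2Z SL2Z_in_SA2Z_morph.

(* A predicate, and not a [set]: universe constraints of the libraries prevent
   the type of all unitary representations from being an argument of [set]. *)
Definition irrep_induced_from_SL2Z (R : realType)
    (pi : unitaryRep R SA2Z) : Prop :=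
  irreducible_rep pi /\
  exists sigma : unitaryRep R SL2Z,
    irreducible_rep sigma /\ is_induced_from SL2Z_in_SA2Z sigma pi.

(* Main.v *)
Require Import Defs.
From mathcomp Require Import all_boot all_order all_algebra.
From mathcomp Require Import all_classical all_reals all_analysis.
From mathcomp Require Import complex ring lra zify.

Set Implicit Arguments.
Unset Strict Implicit.
Unset Printing Implicit Defensive.

Import Order.TTheory GRing.Theory Num.Theory.
Import numFieldNormedType.Exports.

Local Open Scope classical_set_scope.
Local Open Scope ring_scope.

(** Let pi be induced from sigma, let S generate SA(2,Z), and let a unit vector
    xi be moved by at most e by every element of S.  The vector xi is an
    equivariant function on SA(2,Z); restricting it to the translations and
    taking norms gives a nonnegative function f on Z^2 with sum of squares 1.
    Elements of SL(2,Z) act on the values through the unitary sigma, so g moves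
    f, for the affine action on Z^2, by at most the displacement of xi.  Hence
    it is enough to find an e that depends on nothing and makes such an f
    impossible ([no_almost_invariant_function]).

    The affine action has large point stabilisers, and almost invariant
    functions cannot be excluded by looking at single points.  The pairs (x, y)
    weighted by (f x * f y)^2 are better: the difference x - y is transformed by
    the linear part alone, so it has an almost invariant distribution for the
    linear action on Z^2.  If that action has no almost invariant probability
    away from 0, then most of the weight sits on the diagonal, the sum of f^4 is
    close to 1, and f^2 has an atom x of weight above 2/3.  Some s in S moves x,
    and then f^2 would have two atoms of weight above 1/2: contradiction.

    The gap of the linear action comes from a ping-pong between a matrix h and
    a matrix b ([linear_pingpong]).  If h has eigenvalues l and 1/l with
    |l| >= 2, the vectors whose eigencoordinates (x, y) satisfy
    |l|^-3 < c |x / y| < |l|^3 form a cone that is disjoint from its images by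
    h^3 and h^6, so it carries about a third of the mass at most.  If b does not
    map an eigenline of h to an eigenline of h, then for suitable c1 and c2 it
    sends every nonzero vector outside the first cone into the second one
    ([cone_swap]); the nonzero mass m thus satisfies m <= 2 m / 3 + small.

    What remains is to find h and b uniformly in S.  Every class of
    SL(2,Z) modulo 6 is represented by a word in S of length bounded by the
    order of M_2(Z/6) ([short_words_fill_quotient]), and being a good pair
    (h, b) is guaranteed by congruences modulo 6 ([mod6_pingpong]): they force
    |tr h| >= 3 and the nonvanishing of two integer determinants that measure
    how far b is from permuting the eigenlines of h.  As nonzero integers these
    are at least 1 in absolute value, which is the quantitative separation that
    [cone_swap] asks for. *)

(** * Ping-pong on the directions of the plane *)

Section PingPong.
Variable R : rcfType.
Implicit Types (c K L l x y p q r s : R).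

(** The vectors, in coordinates (x, y), whose slope is within a factor K of c; for
    positive c and K it avoids both axes. *)
Definition middle_cone K c x y : bool :=
  (`|y| < K * c * `|x|) && (c * `|x| < K * `|y|).

(** The diagonal map divides the slope |y / x| by |a|^2, while the slopes of the
    cone spread over a factor K^2 only. *)
Lemma middle_cone_disjoint K c a x y : 0 < K -> 0 < c -> K <= `|a| ->
  middle_cone K c x y -> ~~ middle_cone K c (a * x) (a^-1 * y).
Proof.
move=> K0 c0 Ka /andP[h1 _]; apply/negP => /andP[_].
have a0 : 0 < `|a| by exact: lt_le_trans Ka.
rewrite !normrM normfV mulrA => h2.
have x0 : 0 <= c * `|x| by rewrite mulr_ge0// ltW.
have h3 : K * (`|a|^-1 * `|y|) <= `|y|.
  by rewrite mulrA ler_piMl// ler_pdivrMr// mul1r.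
have : c * `|a| * `|x| < K * c * `|x|.
  exact: lt_trans (lt_le_trans h2 h3) h1.
by apply/negP; rewrite -leNgt -!mulrA mulrCA ler_pM2l// ler_wpM2r.
Qed.

(** In balanced coordinates, where |p| = |s| and |q| = |r|, the four entries have
    ratios between 1/L and L.  A vector with |y| <= |x| / L^3 is so close to the
    first axis that its image has, up to a factor 5/3, the slope of the first
    column, and 5/3 * L < L^3. *)
Lemma cone_swap_lt L p q r s x y :
  2 <= L -> `|p| = `|s| -> `|q| = `|r| -> `|q| <= L * `|p| ->
  `|p| <= L * `|q| -> p != 0 -> x != 0 -> L ^+ 3 * `|y| <= `|x| ->
  `|p * x + q * y| < L ^+ 3 * `|r * x + s * y|.
Proof.
move=> L2 ps qr qp pq p0 x0 yx.
have x_gt0 : 0 < `|x| by rewrite normr_gt0.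
have p_gt0 : 0 < `|p| by rewrite normr_gt0.
have up : `|p * x + q * y| <= `|p| * `|x| + `|q| * `|y|.
  by rewrite -!normrM ler_normD.
have lo : `|q| * `|x| - `|p| * `|y| <= `|r * x + s * y|.
  by rewrite ps qr -!normrM lerB_normD.
have yy := normr_ge0 y.
set P := `|p| in p_gt0 up lo qp pq *; set Q := `|q| in up lo qp pq *.
set X := `|x| in x_gt0 up lo yx *; set Y := `|y| in up lo yx yy *.
have L3 : L ^+ 3 = L * (L * L) by rewrite !exprS expr0 mulr1.
have LL : 4 <= L * L by nra.
have LY : L * Y * 4 <= X.
  by apply: le_trans yx; rewrite L3 -!mulrA ler_pM2l; nra.
have QY : Q * Y * 4 <= P * X by nra.
have PY : P * Y * 4 <= Q * X by nra.
have PX : 0 < P * X by exact: mulr_gt0.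
have h1 : P * X <= L * (Q * X) by rewrite mulrA ler_pM2r.
have h2 : 3 * (Q * X) <= 4 * `|r * x + s * y| by lra.
have h3 : 4 * `|p * x + q * y| <= 5 * (P * X) by lra.
rewrite L3 -!mulrA; have h4 : 3 * (P * X) <= 4 * (L * `|r * x + s * y|) by nra.
set Z := L * `|r * x + s * y| in h4.
have -> : L * (L * (L * `|r * x + s * y|)) = L * L * Z by rewrite /Z; ring.
nra.
Qed.

Lemma cone_swap_mid L p q r s x y :
  2 <= L -> `|p| = `|s| -> `|q| = `|r| -> `|q| <= L * `|p| ->
  `|p| <= L * `|q| -> p != 0 -> q != 0 -> x != 0 -> L ^+ 3 * `|y| <= `|x| ->
  middle_cone (L ^+ 3) 1 (p * x + q * y) (r * x + s * y).
Proof.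
move=> L2 ps qr qp pq p0 q0 x0 yx; rewrite /middle_cone mulr1 mul1r.
rewrite (cone_swap_lt L2 ps qr)// andbT.
apply: (@cone_swap_lt L r s p q) => //; rewrite -?ps -?qr//.
by rewrite -normr_eq0 -qr normr_eq0.
Qed.

(** The four ratios of entries of the matrix (p q ; r s) cannot be controlled
    separately, but rescaling the axes independently in the source (by c1) and
    in the target (by c2) balances the matrix.  Only the cross-ratio
    p s / (q r) of the two images of the axes is invariant, and it is what the
    hypotheses bound. *)
Lemma cone_swap L p q r s : 2 <= L ->
  `|p * s| <= L ^+ 2 * `|q * r| -> `|q * r| <= L ^+ 2 * `|p * s| ->
  p * s != 0 -> q * r != 0 ->
  exists c1 c2, [/\ 0 < c1, 0 < c2 & forall x y, (x != 0) || (y != 0) ->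
    middle_cone (L ^+ 3) c1 x y ||
    middle_cone (L ^+ 3) c2 (p * x + q * y) (r * x + s * y)].
Proof.
move=> L2 h1 h2; rewrite !mulf_eq0 !negb_or => /andP[p0 s0] /andP[q0 r0].
have L0 : 0 < L by lra.
have [P Q] : 0 < `|p| /\ 0 < `|q| by rewrite !normr_gt0.
have [T S] : 0 < `|r| /\ 0 < `|s| by rewrite !normr_gt0.
pose c1 := Num.sqrt (`|r| * `|p| / (`|q| * `|s|)).
pose c2 := Num.sqrt (`|r| * `|s| / (`|q| * `|p|)).
have c1_gt0 : 0 < c1 by rewrite sqrtr_gt0 divr_gt0 ?mulr_gt0.
have c2_gt0 : 0 < c2 by rewrite sqrtr_gt0 divr_gt0 ?mulr_gt0.
have c12 : c1 ^+ 2 = `|r| * `|p| / (`|q| * `|s|).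
  by rewrite sqr_sqrtr// divr_ge0 ?mulr_ge0.
have c22 : c2 ^+ 2 = `|r| * `|s| / (`|q| * `|p|).
  by rewrite sqr_sqrtr// divr_ge0 ?mulr_ge0.
have e1 : c2 * `|p| / c1 = `|s|.
  apply/(pexpIrn (n := 2)); rewrite ?nnegrE ?divr_ge0 ?mulr_ge0 ?ltW//.
  rewrite expr_div_n exprMn c12 c22; field.
  by rewrite !lt0r_neq0.
have e2 : c2 * `|q| = `|r| / c1.
  apply/(pexpIrn (n := 2)); rewrite ?nnegrE ?divr_ge0 ?mulr_ge0 ?ltW//.
  rewrite expr_div_n exprMn c12 c22; field.
  by rewrite !lt0r_neq0.
exists c1, c2; split=> // x y xy.
have [//|nm] /= := boolP (middle_cone _ c1 x y).
have K0 : 0 < L ^+ 3 by rewrite exprn_gt0.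
(* The balanced matrix is (p' q' ; r' s), acting on (c1 x, y). *)
set p' := c2 * p / c1; set q' := c2 * q; set r' := r / c1.
have ps' : `|p'| = `|s|.
  by rewrite /p' !normrM normfV !(gtr0_norm c1_gt0) !(gtr0_norm c2_gt0).
have qr' : `|q'| = `|r'|.
  by rewrite /q' /r' !normrM normfV !(gtr0_norm c1_gt0) !(gtr0_norm c2_gt0).
have pp' : `|p'| ^+ 2 = c2 / c1 * `|p * s|.
  by rewrite expr2 {2}ps' /p' -normrM [in RHS]normrM !normrM normfV
     !(gtr0_norm c1_gt0) !(gtr0_norm c2_gt0); ring.
have qq' : `|q'| ^+ 2 = c2 / c1 * `|q * r|.
  by rewrite expr2 {2}qr' /q' /r' !normrM normfV
     !(gtr0_norm c1_gt0) !(gtr0_norm c2_gt0); ring.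
have c21 : 0 <= c2 / c1 by rewrite divr_ge0 ?ltW.
have q'p' : `|q'| <= L * `|p'|.
  rewrite -(ler_pXn2r (n := 2)) ?nnegrE ?mulr_ge0 ?(ltW L0)//.
  by rewrite exprMn pp' qq' mulrCA ler_wpM2l.
have p'q' : `|p'| <= L * `|q'|.
  rewrite -(ler_pXn2r (n := 2)) ?nnegrE ?mulr_ge0 ?(ltW L0)//.
  by rewrite exprMn pp' qq' mulrCA ler_wpM2l.
have p'0 : p' != 0 by rewrite !mulf_neq0 ?invr_eq0// lt0r_neq0.
have q'0 : q' != 0 by rewrite mulf_neq0// lt0r_neq0.
have mid : middle_cone (L ^+ 3) 1 (p' * (c1 * x) + q' * y)
                                  (r' * (c1 * x) + s * y).
  have := nm; rewrite negb_and -!leNgt => /orP[|] h.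
  - have y0 : y != 0.
      apply: contraL xy => /eqP y0; move: h; rewrite y0 normr0 eqxx orbF negbK.
      by rewrite pmulr_rle0 ?mulr_gt0// normr_le0.
    rewrite [X in middle_cone _ _ X]addrC [X in middle_cone _ _ _ X]addrC.
    rewrite /middle_cone andbC mulr1 mul1r.
    have := @cone_swap_mid L s r' q' p' y (c1 * x).
    rewrite /middle_cone mulr1 mul1r; apply => //.
    + by rewrite -qr' -ps'.
    + by rewrite -qr' -ps'.
    + by rewrite -normr_eq0 -qr' normr_eq0.
    + by rewrite normrM (gtr0_norm c1_gt0) mulrA.
  - have x0 : x != 0.
      apply: contraL xy => /eqP x0; move: h.
      rewrite x0 normr0 mulr0 eqxx orFb negbK.
      by rewrite pmulr_rle0// normr_le0.
    apply: cone_swap_mid => //; first by rewrite mulf_neq0// lt0r_neq0.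
    by rewrite normrM (gtr0_norm c1_gt0).
have e3 : p' * (c1 * x) + q' * y = c2 * (p * x + q * y).
  by rewrite /p' /q'; field; rewrite lt0r_neq0.
have e4 : r' * (c1 * x) + s * y = r * x + s * y.
  by rewrite /r'; field; rewrite lt0r_neq0.
move: mid; rewrite e3 e4 /middle_cone normrM (gtr0_norm c2_gt0).
by rewrite mulr1 mul1r -mulrA.
Qed.
End PingPong.

(** * Eigencoordinates of a two by two matrix *)

Lemma det_mx2 (K : comPzRingType) (A : 'M[K]_2) :
  \det A = A 0 0 * A 1 1 - A 0 1 * A 1 0.
Proof.
rewrite (expand_det_row _ 0) !big_ord_recl big_ord0 /cofactor !det_mx11 !mxE /=.
rewrite expr0 mul1r addr0 expr1 mulN1r mulrN.
by congr (A _ _ * A _ _ - A _ _ * A _ _); apply/val_inj.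
Qed.

Lemma mulmx2E (K : pzRingType) n (A : 'M[K]_2) (B : 'M[K]_(2, n)) i j :
  (A *m B) i j = A i 0 * B 0 j + A i 1 * B 1 j.
Proof.
rewrite !mxE !big_ord_recl big_ord0 addr0.
by congr (A _ _ * B _ _ + A _ _ * B _ _); apply/val_inj.
Qed.

Lemma subr_mxE (K : pzRingType) m n (A B : 'M[K]_(m, n)) i j :
  (A - B) i j = A i j - B i j.
Proof. by rewrite !mxE. Qed.

Lemma mxtrace2 (K : pzRingType) (A : 'M[K]_2) : \tr A = A 0 0 + A 1 1.
Proof.
rewrite /mxtrace !big_ord_recl big_ord0 addr0.
by congr (_ + A _ _); apply/val_inj.
Qed.

Lemma adj_mx2 (K : comPzRingType) (A : 'M[K]_2) :
  (\adj A 0 0 = A 1 1) * (\adj A 0 1 = - A 0 1) *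
  (\adj A 1 0 = - A 1 0) * (\adj A 1 1 = A 0 0).
Proof.
do !split; rewrite mxE /cofactor det_mx11 !mxE ?expr0 ?sqrrN ?expr1n ?mul1r
  ?expr1 ?mulN1r; (try congr (- _)); by congr (A _ _); apply/val_inj.
Qed.

(** X and Y are the two left eigenvectors of H = (a b ; c d), and (p q ; r s) is
    the matrix of B = (e f ; g k) in these coordinates.  There H is diagonal, so
    H B - B H has antidiagonal entries (l - 1/l) q and -(l - 1/l) r, and
    H B - B H^-1 has diagonal entries (l - 1/l) p and -(l - 1/l) s.  The two
    right-hand sides are the determinants of these matrices, written with the
    original entries: for integer H and B they are integers, although p, q, r
    and s are irrational. *)
Lemma eigen_coordinates (K : fieldType) (a b c d e f g k l : K) :
    a * d - b * c = 1 -> l + l^-1 = a + d -> l != 0 -> l - l^-1 != 0 ->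
    c != 0 ->
  exists X Y : K -> K -> K,
  [/\ forall v w, X (a * v + b * w) (c * v + d * w) = l * X v w,
      forall v w, Y (a * v + b * w) (c * v + d * w) = l^-1 * Y v w,
      forall v w, X v w = 0 -> Y v w = 0 -> v = 0 /\ w = 0
    & exists p q r s, [/\
      forall v w, X (e * v + f * w) (g * v + k * w) = p * X v w + q * Y v w,
      forall v w, Y (e * v + f * w) (g * v + k * w) = r * X v w + s * Y v w,
      p * s - q * r = e * k - f * g,
      (l - l^-1) ^+ 2 * (q * r) =
       (b * g - f * c) * (c * f - g * b) -
       (a * f + b * k - (e * b + f * d)) * (c * e + d * g - (g * a + k * c))
    & - ((l - l^-1) ^+ 2 * (p * s)) =
       (a * e + b * g - (e * d - f * c)) * (c * f + d * k - (k * a - g * b)) -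
       (a * f + b * k - (f * a - e * b)) * (c * e + d * g - (g * d - k * c))]].
Proof.
move=> det1 tr l0 dl c0.
pose X v w := c * v + (l - a) * w; pose Y v w := c * v + (l^-1 - a) * w.
exists X, Y.
have de : d = l + l^-1 - a by rewrite tr addrAC subrr add0r.
have be : b = (a * d - 1) / c by rewrite -det1; field.
have ll : l * l - 1 != 0.
  apply: contra dl => /eqP h.
  by rewrite -(mulrI_eq0 _ (mulfI l0)) mulrBr mulfV// h.
split.
- by move=> v w; rewrite /X be de; field; rewrite l0.
- by move=> v w; rewrite /Y be de; field; rewrite l0.
- move=> v w hX hY.
  have w0 : w = 0.
    apply: (mulfI dl); rewrite mulr0 -[RHS](subrr 0) -{1}hX -hY /X /Y; ring.
  split=> //; apply: (mulfI c0); rewrite mulr0 -hX /X w0; ring.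
(* (p q ; r s) is P B P^-1, where P has rows (c, l - a) and (c, l^-1 - a). *)
pose D := c * (l^-1 - l).
pose m1 := c * e + (l - a) * g; pose m2 := c * f + (l - a) * k.
pose n1 := c * e + (l^-1 - a) * g; pose n2 := c * f + (l^-1 - a) * k.
exists ((m1 * (l^-1 - a) - c * m2) / D), ((c * m2 - m1 * (l - a)) / D),
  ((n1 * (l^-1 - a) - c * n2) / D), ((c * n2 - n1 * (l - a)) / D).
have ll' : 1 - l * l != 0 by rewrite -oppr_eq0 opprB.
by split; [move=> v w|move=> v w|..]; rewrite /X /Y /m1 /m2 /n1 /n2 /D ?be ?de;
  field; rewrite ?mulNr ?ll' ?ll ?l0 ?c0.
Qed.


(** The last conjunct compares the discriminant t^2 - 4 = (l - 1/l)^2 of the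
    characteristic polynomial with l^2, the spread of slopes that ping-pong
    with this eigenvalue can afford. *)
Lemma large_eigenvalue (R : rcfType) (t : R) : 3 <= `|t| ->
  exists l : R,
  [/\ 2 <= `|l|, l + l^-1 = t & 1 < (l - l^-1) ^+ 2 + 1 <= l ^+ 2].
Proof.
wlog t0 : t / 0 <= t => [H|]; last rewrite ger0_norm// => t3.
  have [|/ltW tle0] := leP 0 t; first exact: H.
  rewrite -normrN => /(H (- t)); rewrite oppr_ge0 => /(_ tle0)[l [l2 lt ll]].
  exists (- l); rewrite invrN normrN; split=> //; first by rewrite -opprD lt opprK.
  by rewrite -opprD sqrrN sqrrN.
pose s := Num.sqrt (t ^+ 2 - 4).
have s2 : s ^+ 2 = t ^+ 2 - 4 by rewrite sqr_sqrtr//; nra.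
have s0 : 1 <= s by rewrite -(ler_pXn2r (n := 2)) ?nnegrE ?sqrtr_ge0// s2; nra.
have l0 : (t + s) / 2 != 0 by rewrite lt0r_neq0//; lra.
have lV : ((t + s) / 2)^-1 = (t - s) / 2.
  apply: (mulfI l0); rewrite mulfV//.
  have -> : (t + s) / 2 * ((t - s) / 2) = (t ^+ 2 - s ^+ 2) / 4 by field.
  by rewrite s2; field.
exists ((t + s) / 2); rewrite lV; split.
- by rewrite ger0_norm; lra.
- by field.
- have -> : (t + s) / 2 - (t - s) / 2 = s by field.
  have -> : ((t + s) / 2) ^+ 2 = (t ^+ 2 + s ^+ 2 + 2 * (t * s)) / 4 by field.
  have st : s <= t by rewrite -(ler_pXn2r (n := 2)) ?nnegrE// ?s2; lra.
  apply/andP; split; first by nra.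
  have : s ^+ 2 <= t * s by nra.
  lra.
Qed.

(** * A uniform ping-pong for pairs of integer matrices *)


(** A nonzero integer is at least 1 in absolute value, so a translation by D
    multiplies it by D + 1 at most; this is where integrality turns
    nonvanishing into a quantitative bound. *)
Lemma int_dist_le_mul (R : realFieldType) (D y : R) (u : int) :
  0 < D -> u != 0 -> y = u%:~R + D \/ y = u%:~R - D ->
  `|y| <= (D + 1) * `|u%:~R|.
Proof.
move=> D0 u0 yE.
have u1 : 1 <= `|u%:~R : R| by rewrite -intr_norm (ler_int _ 1) -gtz0_ge1 normr_gt0.
have : `|y| <= `|u%:~R| + D.
  case: yE => ->; first by rewrite (le_trans (ler_normD _ _))// (gtr0_norm D0).
  by rewrite (le_trans (ler_normB _ _))// (gtr0_norm D0).
nra.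
Qed.

(** W1 and W2 are middle cones for eigencoordinates of h.  The determinants of
    h b - b h and h b - b h^-1 (the adjugate is the inverse) are, up to sign,
    D q r and D p s in the notation of [eigen_coordinates], with D = (l - 1/l)^2;
    they differ in absolute value by at most D because p s - q r = 1, and being
    nonzero integers they have a ratio between 1 / l^2 and l^2. *)
Lemma linear_pingpong (R : rcfType) (h b : 'M[int]_2) :
    \det h = 1 -> \det b = 1 -> (3 <= `|\tr h|)%R ->
    \det (h *m b - b *m h) != 0 -> \det (h *m b - b *m \adj h) != 0 ->
  exists W1 W2 : set 'cV[int]_2,
  (forall v, v != 0 -> W1 v \/ W2 (b *m v)) /\
  (forall n v, (3 <= n)%N -> (W1 v -> ~ W1 (iter n (mulmx h) v)) /\
                             (W2 v -> ~ W2 (iter n (mulmx h) v))).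
Proof.
rewrite mxtrace2 !det_mx2 => deth detb h3.
have h10 : h 1 0 != 0.
  apply/eqP => h10; move: deth h3; rewrite h10 mulr0 subr0.
  move: (h 0 0) (h 1 1) => x y /(congr1 absz); rewrite abszM => /eqP.
  by rewrite muln_eq1 => /andP[/eqP ? /eqP ?]; lia.
rewrite !subr_mxE !mulmx2E !adj_mx2.
set u := (X in X != 0) => u0; set w := (X in X != 0) => w0.
have t3 : 3 <= `|(h 0 0 + h 1 1)%:~R : R| by rewrite -intr_norm (ler_int _ 3).
have [l [l2 lt /andP[D0 Dl]]] := large_eigenvalue t3.
have l0 : l != 0 by rewrite -normr_gt0; lra.
have dl : l - l^-1 != 0.
  by apply/eqP => e; move: D0; rewrite e expr0n add0r ltxx.
have det1 : (h 0 0)%:~R * (h 1 1)%:~R - (h 0 1)%:~R * (h 1 0)%:~R = 1 :> R.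
  by rewrite -!intrM -intrB deth.
have lt' : l + l^-1 = (h 0 0)%:~R + (h 1 1)%:~R by rewrite lt intrD.
have c0 : (h 1 0)%:~R != 0 :> R by rewrite intr_eq0.
have [X [Y [hX hY XY0 [p [q [r [s [bX bY pqrs qr ps]]]]]]]] :=
  eigen_coordinates (b 0 0)%:~R (b 0 1)%:~R (b 1 0)%:~R (b 1 1)%:~R
    det1 lt' l0 dl c0.
have qrE : (l - l^-1) ^+ 2 * (q * r) = u%:~R.
  by rewrite qr /u !(intrB, intrD, intrM); ring.
have psE : (l - l^-1) ^+ 2 * (p * s) = - w%:~R.
  by rewrite -[LHS]opprK ps /w !(intrB, intrD, intrM, intrN); ring.
set D := (l - l^-1) ^+ 2 in D0 Dl qrE psE.
have {}D0 : 0 < D by lra.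
have pqrs1 : p * s - q * r = 1 by rewrite pqrs -!intrM -intrB detb.
have psqr : D * (p * s) = D * (q * r) + D.
  by rewrite -[p * s](subrK (q * r)) pqrs1 mulrDr mulr1 addrC.
have bnd x y (z : int) : z != 0 -> D * x = D * y + D \/ D * x = D * y - D ->
    D * y = z%:~R -> `|x| <= `|l| ^+ 2 * `|y|.
  move=> z0 xy yz; rewrite -(ler_pM2l D0) mulrCA -{1 2}(gtr0_norm D0) -!normrM yz.
  rewrite real_normK ?num_real//.
  apply: (@le_trans _ _ ((D + 1) * `|z%:~R|)); last by rewrite ler_wpM2r.
  by apply: int_dist_le_mul => //; rewrite -yz.
have ps0 : p * s != 0.
  by rewrite -(mulrI_eq0 _ (mulfI (lt0r_neq0 D0))) psE oppr_eq0 intr_eq0.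
have qr0 : q * r != 0.
  by rewrite -(mulrI_eq0 _ (mulfI (lt0r_neq0 D0))) qrE intr_eq0.
have [||c1 [c2 [c1_0 c2_0 swap]]] := cone_swap l2 _ _ ps0 qr0.
- by apply: (bnd _ _ u) => //; left.
- apply: (bnd _ _ (- w)); rewrite ?oppr_eq0 ?intrN//.
  by right; rewrite psqr addrK.
have K0 : 0 < `|l| ^+ 3 by rewrite exprn_gt0// normr_gt0.
pose x (v : 'cV[int]_2) := X (v 0 0)%:~R (v 1 0)%:~R.
pose y (v : 'cV[int]_2) := Y (v 0 0)%:~R (v 1 0)%:~R.
pose W c := [set v : 'cV[int]_2 | middle_cone (`|l| ^+ 3) c (x v) (y v)].
have xh v : x (h *m v) = l * x v.
  by rewrite /x !mulmx2E !(intrD, intrM) hX.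
have yh v : y (h *m v) = l^-1 * y v.
  by rewrite /y !mulmx2E !(intrD, intrM) hY.
have xhn n v : x (iter n (mulmx h) v) = l ^+ n * x v.
  by elim: n => [|n IH]; rewrite ?mul1r// iterS xh IH exprS mulrA.
have yhn n v : y (iter n (mulmx h) v) = (l ^+ n)^-1 * y v.
  elim: n => [|n IH]; first by rewrite expr0 invr1 mul1r.
  by rewrite iterS yh IH exprS invfM mulrA.
exists (W c1), (W c2); split=> [v v0|n v n3].
  have bv : x (b *m v) = p * x v + q * y v /\ y (b *m v) = r * x v + s * y v.
    by rewrite /x /y !mulmx2E !(intrD, intrM) bX bY.
  rewrite /W /= bv.1 bv.2; apply/orP/swap; apply: contraNT v0.
  rewrite negb_or !negbK => /andP[/eqP xv /eqP yv].
  have [/eqP v0 /eqP v1] := XY0 _ _ xv yv; rewrite !intr_eq0 in v0 v1.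
  apply/eqP/matrixP => i j; rewrite mxE (ord1 j).
  by case: i => [[|[|//]] Hi]; [rewrite -[RHS](eqP v0)|rewrite -[RHS](eqP v1)];
    congr (v _ _); apply/val_inj.
have Kn : `|l| ^+ 3 <= `|l ^+ n| by rewrite normrX ler_weXn2l//; lra.
by split=> Wv; apply/negP; rewrite /W /= xhn yhn; apply: middle_cone_disjoint.
Qed.

(** * Words of bounded length fill every finite quotient *)

(** The residues of the words of length at most k in S increase with k, so they
    are constant from k = #|Q| on.  The stable set B is closed under right
    multiplication by the residues of S; the g whose residue preserves B form
    a subgroup, because an injection of the finite set B into itself is onto,
    hence every residue lies in B.  The function len, subadditive and at most e
    on S, plays the role of the word length times e. *)
Lemma short_words_fill_quotient (R : realFieldType) (G : groupType)
    (Q : finNzRingType) (res : G -> Q) (len : G -> R) (S : set G) (e : R) :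
    res 1%g = 1 -> (forall g h, res (g * h)%g = res g * res h) ->
    len 1%g = 0 -> (forall g h, len (g * h)%g <= len g + len h) ->
    group_generated_by S -> 0 <= e -> (forall s, S s -> len s <= e) ->
  forall g, exists2 g', res g' = res g & len g' <= #|Q|%:R * e.
Proof.
move=> res1 resM len1 lenM genS e0 lenS.
pose T : {set Q} := [set c | `[< exists2 s, S s & res s = c >]]%SET.
pose F (X : {set Q}) : {set Q} := (1 |: [set x * y | x in X, y in T])%SET.
have F_mono : {homo F : X Y / X \subset Y}.
  by move=> X Y XY; apply: finset.setUS; apply: imset2S.
pose B := fixset F.
have B1 : 1 \in B by rewrite /B -fixsetK// !inE eqxx.
have BS c s : c \in B -> S s -> c * res s \in B.
  move=> cB Ss; rewrite /B -fixsetK//; apply/setU1P; right.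
  by apply/imset2P; exists c (res s) => //; rewrite inE; apply/asboolP; exists s.
have short k c : c \in iter k F finset.set0 ->
    exists2 g, res g = c & len g <= k%:R * e.
  elim: k c => [|k IH] c; first by rewrite inE.
  move=> /setU1P[->|/imset2P[x y /IH[g gx lg]]].
    by exists 1%g => //; rewrite len1 mulr_ge0.
  rewrite inE => /asboolP[s Ss sy] ->.
  exists (g * s)%g; first by rewrite resM gx sy.
  by rewrite (le_trans (lenM _ _))// mulrSr mulrDl mul1r lerD// lenS.
pose P : {pred G} := [pred g | [forall x in B, x * res g \in B]].
have PP g : reflect (forall x, x \in B -> x * res g \in B) (g \in P).
  exact: (iffP forall_inP).
have P1 : 1%g \in P by apply/PP => x xB; rewrite res1 mulr1.
have PV g h : g \in P -> h \in P -> (g * h^-1)%g \in P.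
  move=> /PP gP /PP hP; apply/PP => x xB.
  have im : [set y * res h | y in B]%SET = B.
    apply/eqP; rewrite eqEcard; apply/andP; split.
      by apply/fintype.subsetP => _ /imsetP[y yB ->]; exact: hP.
    rewrite card_imset// => y z /(congr1 ( *%R^~ (res h^-1%g))).
    by rewrite /= -!mulrA -resM mulgV res1 !mulr1.
  have := gP x xB; rewrite -{1}im => /imsetP[y yB xy].
  by rewrite resM mulrA xy -mulrA -resM mulgV res1 mulr1.
move=> g; apply: (short #|Q|).
have gP : g \in P.
  by apply: genS => // s Ss; apply/PP => x xB; exact: BS.
by have /PP/(_ _ B1) := gP; rewrite mul1r.
Qed.

(** * A ping-pong pair defined by congruences modulo 6 *)

Definition lin_mod6 (g : SA2Z) : 'M['Z_6]_2 := map_mx intr (SA2Z_lin g).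

Lemma lin_mod6_1 : lin_mod6 1%g = 1.
Proof. by rewrite /lin_mod6 map_mx1. Qed.

Lemma lin_mod6M g h : lin_mod6 (g * h)%g = lin_mod6 g * lin_mod6 h.
Proof. by rewrite /lin_mod6 map_mxM. Qed.

(** The matrix (2 1 ; 1 1), of trace 3.  With (1 1 ; 0 1) as second matrix, the
    two determinants of [linear_pingpong] are -1 and -4. *)
Definition pingpong_h : 'M[int]_2 := const_mx 1 + delta_mx 0 0.
Definition pingpong_b : 'M[int]_2 := 1%:M + delta_mx 0 1.

Lemma det_pingpong_h : \det pingpong_h = 1.
Proof. by rewrite det_mx2 !mxE. Qed.

Lemma det_pingpong_b : \det pingpong_b = 1.
Proof. by rewrite det_mx2 !mxE. Qed.

(** All three conditions are visible modulo 6: an integer congruent to 3 is not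
    among -2, ..., 2, and neither -1 nor -4 is divisible by 6. *)
Lemma mod6_pingpong (h b : 'M[int]_2) :
    map_mx intr h = map_mx intr pingpong_h :> 'M['Z_6]_2 ->
    map_mx intr b = map_mx intr pingpong_b :> 'M['Z_6]_2 ->
  [/\ 3 <= `|\tr h|, \det (h *m b - b *m h) != 0
    & \det (h *m b - b *m \adj h) != 0].
Proof.
move=> hE bE.
have mod6_neq0 (n m : int) : n%:~R = m%:~R :> 'Z_6 -> m%:~R != 0 :> 'Z_6 -> n != 0.
  by move=> nm; apply: contraNneq => n0; rewrite -nm n0.
have trE : (\tr h)%:~R = (\tr pingpong_h)%:~R :> 'Z_6.
  by rewrite -!trace_map_mx hE.
split.
- have {}trE : (\tr h)%:~R = 3%:~R :> 'Z_6.
    by rewrite trE mxtrace2 !mxE.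
  move: (\tr h) trE => t tE; rewrite leNgt; apply/negP => t3.
  have : t \in [:: -2; -1; 0; 1; 2] by rewrite !inE; lia.
  by rewrite !inE => /or4P[|||/orP[|]] /eqP tE'; move: tE; rewrite tE' => /eqP.
- apply: (mod6_neq0 _
    (\det (pingpong_h *m pingpong_b - pingpong_b *m pingpong_h))).
    by rewrite -!det_map_mx !(map_mxB, map_mxM) hE bE.
  by rewrite det_mx2 !subr_mxE !mulmx2E !mxE.
- apply: (mod6_neq0 _
    (\det (pingpong_h *m pingpong_b - pingpong_b *m \adj pingpong_h))).
    by rewrite -!det_map_mx !(map_mxB, map_mxM, map_mx_adj) hE bE.
  by rewrite det_mx2 !subr_mxE !mulmx2E !adj_mx2 !mxE.
Qed.

(** * Mass of a set for a summable weight *)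

Section Mass.
Variables (R : realType) (X : choiceType).
Implicit Types (w f : X -> R) (E : set X).

Lemma esumZl (E : set X) (c : R) (a : X -> \bar R) :
    0 <= c -> (forall x, (0 <= a x)%E) ->
  (\esum_(x in E) (c%:E * a x) = c%:E * \esum_(x in E) a x)%E.
Proof.
move=> c0 a0; rewrite /esum -ereal_supZl//; last first.
  by apply/set0P; exists 0%E; exists set0; [exact: fsets_set0|rewrite fsbig_set0].
congr ereal_sup; apply/seteqP; split=> [_ [A fA <-]|_ [_ [A fA <-] <-]].
  exists (\sum_(x \in A) a x)%E; first by exists A.
  by rewrite ge0_mule_fsumr.
by exists A => //; rewrite ge0_mule_fsumr.
Qed.

Lemma le_esum_set (A B : set X) (a : X -> \bar R) :
    (forall x, (0 <= a x)%E) -> A `<=` B ->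
  (\esum_(x in A) a x <= \esum_(x in B) a x)%E.
Proof.
move=> a0 AB; rewrite esum_mkcond [leRHS]esum_mkcond; apply: le_esum => x _.
case: ifPn => [/set_mem/AB/mem_set -> //|_]; by case: ifP.
Qed.

Definition mass w E : R := fine (\esum_(x in E) (w x)%:E).

Section Probability.
Variable w : X -> R.
Hypothesis w_ge0 : forall x, 0 <= w x.
Hypothesis w_sum1 : (\esum_(x in setT) (w x)%:E = 1)%E.

Lemma massE E : (\esum_(x in E) (w x)%:E)%E = (mass w E)%:E.
Proof.
rewrite fineK// ge0_fin_numE; last by apply: esum_ge0 => x _; rewrite lee_fin.
apply: (@le_lt_trans _ _ 1%E); last exact: ltry.
by rewrite -w_sum1; exact: le_esum_set.
Qed.

Lemma massT : mass w setT = 1. Proof. by rewrite /mass w_sum1. Qed.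

Lemma le_mass A B : A `<=` B -> mass w A <= mass w B.
Proof.
move=> AB; rewrite -lee_fin -!massE; exact: le_esum_set.
Qed.

Lemma massU A B : (forall x, A x -> ~ B x) ->
  mass w (A `|` B) = mass w A + mass w B.
Proof.
move=> AB; apply: EFin_inj; rewrite EFinD -!massE.
rewrite (esumID A) => [|x _]; last by rewrite lee_fin.
congr (_ + _)%E; congr esum; apply/seteqP; split=> x /=.
- by case.
- by move=> Ax; split=> //; left.
- by move=> [[|]].
- by move=> Bx; split; [right|move=> /AB].
Qed.

Lemma mass_leU A B : mass w (A `|` B) <= mass w A + mass w B.
Proof.
have -> : A `|` B = A `|` (B `&` ~` A).
  apply/seteqP; split=> x /=; last by case=> [|[]]; [left|right].
  by case=> [|Bx]; [left|have [|] := pselect (A x); [left|right]].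
rewrite massU => [|x Ax [_ /(_ Ax)]//].
by rewrite lerD2l le_mass// => x [].
Qed.

End Probability.

(** A form of the l^1 bound for the difference of two squares that needs no
    Cauchy-Schwarz inequality: Young's inequality with parameter eta gives
    F'^2 <= (1 + eta) F^2 + (1 + 1/eta) (F' - F)^2 pointwise, and the total
    error is at most eta + 4 eta^2 + 4 eta. *)
Lemma mass_perturb (F F' : X -> R) (eta : R) E : 0 < eta <= 1 ->
    (\esum_(x in setT) (F x ^+ 2)%:E = 1)%E ->
    (\esum_(x in setT) (F' x ^+ 2)%:E = 1)%E ->
    (\esum_(x in setT) ((F' x - F x) ^+ 2)%:E <= (4 * eta ^+ 2)%:E)%E ->
  mass (fun x => F' x ^+ 2) E <= mass (fun x => F x ^+ 2) E + 9 * eta.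
Proof.
move=> /andP[eta0 eta1] F1 F'1 FF'.
have sq0 (G : X -> R) x : 0 <= G x ^+ 2 by exact: sqr_ge0.
have eV0 : 0 < eta^-1 by rewrite invr_gt0.
have young x : F' x ^+ 2 <= (1 + eta) * F x ^+ 2 + (1 + eta^-1) * (F' x - F x) ^+ 2.
  rewrite -subr_ge0.
  have -> : (1 + eta) * F x ^+ 2 + (1 + eta^-1) * (F' x - F x) ^+ 2 - F' x ^+ 2 =
      eta^-1 * (eta * F x - (F' x - F x)) ^+ 2 by field; rewrite lt0r_neq0.
  by rewrite mulr_ge0// ?sqr_ge0// ltW.
have c1 : 0 <= 1 + eta by lra.
have c2 : 0 <= 1 + eta^-1 by lra.
have : ((mass (fun x => F' x ^+ 2) E)%:E <=
    (1 + eta)%:E * (mass (fun x => F x ^+ 2) E)%:E +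
    (1 + eta^-1)%:E * (4 * eta ^+ 2)%:E)%E.
  rewrite -!massE//.
  apply: (@le_trans _ _ (\esum_(x in E) ((1 + eta)%:E * (F x ^+ 2)%:E +
     (1 + eta^-1)%:E * ((F' x - F x) ^+ 2)%:E))%E).
    by apply: le_esum => x _; rewrite -!EFinM -EFinD lee_fin.
  rewrite esumD; try by move=> x _; rewrite -EFinM lee_fin mulr_ge0// ?sqr_ge0.
  rewrite !esumZl//; try by move=> x; rewrite lee_fin ?sqr_ge0.
  rewrite leeD2l// lee_wpmul2l ?lee_fin//; apply: le_trans FF'.
  by apply: le_esum_set => // x; rewrite lee_fin ?sqr_ge0.
rewrite -!EFinM -EFinD lee_fin.
have -> : (1 + eta^-1) * (4 * eta ^+ 2) = 4 * eta ^+ 2 + 4 * eta.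
  by field; rewrite lt0r_neq0.
have := le_mass (sq0 F) F1 (@subsetT _ E); rewrite massT//.
set m := mass _ E => m1; nra.
Qed.

End Mass.

Lemma esum_prod (R : realType) (X Y : choiceType) (a : X -> R) (b : Y -> R)
    (A : \bar R) (B : R) :
    (forall x, 0 <= a x) -> (forall y, 0 <= b y) ->
    (\esum_(x in setT) (a x)%:E = A)%E ->
    (\esum_(y in setT) (b y)%:E = B%:E)%E ->
  (\esum_(p in setT) (a p.1 * b p.2)%:E = A * B%:E)%E.
Proof.
move=> a0 b0 aA bB; have B0 : 0 <= B.
  by rewrite -lee_fin -bB; apply: esum_ge0 => y _; rewrite lee_fin.
have -> : [set: X * Y] = [set: X] `*`` (fun _ => [set: Y]) by apply/seteqP; split.
rewrite -(@esum_esum _ _ _ setT (fun=> setT) (fun x y => (a x * b y)%:E)); last first.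
  by move=> x y _ _; rewrite lee_fin mulr_ge0.
transitivity (\esum_(x in setT) (B%:E * (a x)%:E))%E.
  apply: eq_esum => x _; rewrite muleC -bB -esumZl//.
by rewrite esumZl ?aA 1?muleC// => x; rewrite lee_fin.
Qed.

(** * Almost invariant functions on the affine plane *)

Local Notation Z2 := 'cV[int]_2.

Definition affine_act (g : SA2Z) (x : Z2) : Z2 :=
  SA2Z_lin g *m x + SA2Z_trans g.

Lemma affine_act1 x : affine_act 1%g x = x.
Proof. by rewrite /affine_act mul1mx addr0. Qed.

Lemma affine_actM g h x : affine_act (g * h)%g x = affine_act g (affine_act h x).
Proof. by rewrite /affine_act /= mulmxDr mulmxA -addrA [X in _ + X]addrC. Qed.

Lemma affine_actK g : cancel (affine_act g) (affine_act g^-1%g).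
Proof. by move=> x; rewrite -affine_actM mulVg affine_act1. Qed.

Lemma affine_actVK g : cancel (affine_act g^-1%g) (affine_act g).
Proof. by move=> x; rewrite -affine_actM mulgV affine_act1. Qed.

Lemma affine_actB g x y :
  affine_act g x - affine_act g y = SA2Z_lin g *m (x - y).
Proof. by rewrite /affine_act opprD addrACA subrr addr0 mulmxBr. Qed.

Lemma SA2Z_linX g n (v : Z2) :
  SA2Z_lin (g ^+ n)%g *m v = iter n (mulmx (SA2Z_lin g)) v.
Proof.
elim: n => [|n IH]; first by rewrite expg0 mul1mx.
by rewrite expgS /= -mulmxA IH.
Qed.

(** The stabiliser of a point is a subgroup that misses the translations. *)
Lemma no_fixed_point (S : set SA2Z) x : group_generated_by S ->
  exists2 s, S s & affine_act s x != x.
Proof.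
move=> genS; apply: contrapT => H.
pose P : {pred SA2Z} := [pred g | affine_act g x == x].
have Pgrp : group_closed P.
  split; first by rewrite inE affine_act1.
  move=> g h; rewrite !inE => /eqP gx /eqP hx.
  by rewrite affine_actM -{1}hx affine_actK gx.
have PS s : S s -> s \in P.
  move=> Ss; rewrite inE; apply: contra_notT H => sx; by exists s.
have := genS P Pgrp PS (MkSA2Z 1%g (const_mx 1)).
rewrite inE /affine_act mul1mx /= -subr_eq0 addrAC subrr add0r.
by move=> /eqP/matrixP/(_ 0 0); rewrite !mxE.
Qed.

Lemma set_bij_cancel (X Y : Type) (e : X -> Y) (e' : Y -> X) A B :
  cancel e e' -> cancel e' e -> (forall x, A x <-> B (e x)) -> set_bij A B e.
Proof.
move=> eK e'K AB; split=> [x /AB//|x y _ _ /(can_inj eK)//|y By].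
by exists (e' y) => //; apply/AB; rewrite e'K.
Qed.

Section AlmostInvariant.
Variables (R : realType) (f : Z2 -> R) (len : SA2Z -> R).
Hypothesis f_ge0 : forall x, 0 <= f x.
Hypothesis f_norm1 : (\esum_(x in setT) (f x ^+ 2)%:E = 1)%E.
Hypothesis len1 : len 1%g = 0.
Hypothesis lenM : forall g h, len (g * h)%g <= len g + len h.
Hypothesis len_displ : forall g,
  (\esum_(x in setT) ((f (affine_act g^-1%g x) - f x) ^+ 2)%:E
     <= (len g ^+ 2)%:E)%E.

(** [pair_mass E] is the probability that the difference of two independent
    points of Z^2, each distributed according to f^2, falls in E. *)
Let F (p : Z2 * Z2) := f p.1 * f p.2.
Let pair_mass (E : set Z2) := mass (fun p => F p ^+ 2) [set p | E (p.1 - p.2)].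

Let translate_norm1 g :
  (\esum_(x in setT) (f (affine_act g^-1%g x) ^+ 2)%:E = 1)%E.
Proof.
have bij : set_bij setT setT (affine_act g^-1%g).
  by apply: set_bij_cancel; [exact: affine_actVK|exact: affine_actK|].
by rewrite -[RHS]f_norm1 [RHS](@reindex_esum _ _ _ _ _ _ _ bij).
Qed.

Let square_norm1 (u : Z2 -> R) : (\esum_(x in setT) (u x ^+ 2)%:E = 1)%E ->
  (\esum_(p in setT) ((u p.1 * u p.2) ^+ 2)%:E = 1)%E.
Proof.
move=> u1; rewrite -[RHS]mule1.
rewrite -(@esum_prod _ _ _ (fun x => u x ^+ 2) (fun x => u x ^+ 2) 1%E 1)//.
- by apply: eq_esum => p _; rewrite exprMn.
- by move=> x; apply: sqr_ge0.
- by move=> x; apply: sqr_ge0.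
Qed.

(** The bijection (x, y) |-> (g x, g y) of the pairs acts on differences by the
    linear part of g, and moves F in l^2 by at most twice as much as g moves f. *)
Let pair_mass_le eta g E : len g <= eta -> 0 <= len g -> 0 < eta <= 1 ->
  pair_mass E <= pair_mass [set v | E (SA2Z_lin g *m v)] + 9 * eta /\
  pair_mass [set v | E (SA2Z_lin g *m v)] <= pair_mass E + 9 * eta.
Proof.
move=> lg l0 eta01; have eta0 : 0 <= eta by exact: le_trans lg.
pose f' x := f (affine_act g^-1%g x).
pose F' (p : Z2 * Z2) := f' p.1 * f' p.2.
have f'1 : (\esum_(x in setT) (f' x ^+ 2)%:E = 1)%E := translate_norm1 g.
have F1 := square_norm1 f_norm1; have F'1 := square_norm1 f'1.
pose gg (p : Z2 * Z2) := (affine_act g p.1, affine_act g p.2).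
have -> : pair_mass [set v | E (SA2Z_lin g *m v)] =
    mass (fun p => F' p ^+ 2) [set p | E (p.1 - p.2)].
  have bij : set_bij [set p : Z2 * Z2 | E (SA2Z_lin g *m (p.1 - p.2))]
                     [set p : Z2 * Z2 | E (p.1 - p.2)] gg.
    apply: (@set_bij_cancel _ _ _
      (fun p => (affine_act g^-1%g p.1, affine_act g^-1%g p.2))).
    - by case=> x y; rewrite /gg /= !affine_actK.
    - by case=> x y; rewrite /gg /= !affine_actVK.
    - by case=> x y; rewrite /gg /= affine_actB.
  rewrite /pair_mass /mass (@reindex_esum _ _ _ _ _ _ _ bij); congr fine.
  by apply: eq_esum => p _; rewrite /F' /f' /gg /= !affine_actK.
have [d dE dle] : exists2 d, (\esum_(x in setT) ((f' x - f x) ^+ 2)%:E = d%:E)%E &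
    d <= eta ^+ 2.
  have le_eta : (\esum_(x in setT) ((f' x - f x) ^+ 2)%:E <= (eta ^+ 2)%:E)%E.
    apply: le_trans (len_displ g) _; rewrite lee_fin.
    by rewrite lerXn2r ?nnegrE.
  have fin : (\esum_(x in setT) ((f' x - f x) ^+ 2)%:E)%E \is a fin_num.
    rewrite ge0_fin_numE; first exact: le_lt_trans le_eta (ltry _).
    by apply: esum_ge0 => x _; rewrite lee_fin sqr_ge0.
  by exists (fine (\esum_(x in setT) ((f' x - f x) ^+ 2)%:E)%E);
    rewrite ?fineK// -lee_fin fineK.
have FF' : (\esum_(p in setT) ((F' p - F p) ^+ 2)%:E <= (4 * eta ^+ 2)%:E)%E.
  apply: (@le_trans _ _ (\esum_(p in setT) (2%:E *
      ((f' p.1 - f p.1) ^+ 2 * f' p.2 ^+ 2)%:E +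
      2%:E * (f p.1 ^+ 2 * (f' p.2 - f p.2) ^+ 2)%:E))%E).
    apply: le_esum => -[x y] _; rewrite -!EFinM -EFinD lee_fin /F' /F /=.
    (* With u, v the values of f' and u', v' those of f, write
       u v - u' v' = (u - u') v + u' (v - v'). *)
    rewrite -subr_ge0.
    set u := f' x; set v := f' y; set u' := f x; set v' := f y.
    have -> : 2 * ((u - u') ^+ 2 * v ^+ 2) + 2 * (u' ^+ 2 * (v - v') ^+ 2) -
      (u * v - u' * v') ^+ 2 = ((u - u') * v - u' * (v - v')) ^+ 2 by ring.
    exact: sqr_ge0.
  have nn (x y : R) : 0 <= x ^+ 2 * y ^+ 2 by rewrite mulr_ge0 ?sqr_ge0.
  rewrite esumD; try by move=> p _; rewrite -EFinM lee_fin mulr_ge0.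
  rewrite !esumZl//; try by move=> p; rewrite lee_fin.
  rewrite (@esum_prod _ _ _ (fun x => (f' x - f x) ^+ 2) (fun x => f' x ^+ 2)
    d%:E 1)//;
    try by move=> x; apply: sqr_ge0.
  rewrite (@esum_prod _ _ _ (fun x => f x ^+ 2) (fun x => (f' x - f x) ^+ 2) 1 d)//;
    try by move=> x; apply: sqr_ge0.
  by rewrite mule1 mul1e -!EFinM -EFinD lee_fin; lra.
have F'F : (\esum_(p in setT) ((F p - F' p) ^+ 2)%:E <= (4 * eta ^+ 2)%:E)%E.
  by apply: le_trans FF'; apply: le_esum => p _; rewrite -sqrrN opprB.
by split; apply: mass_perturb.
Qed.

Hypothesis len_ge0 : forall g, 0 <= len g.

Let lenX g n : len (g ^+ n)%g <= n%:R * len g.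
Proof.
elim: n => [|n IH]; first by rewrite expg0 len1 mul0r.
rewrite expgS mulrS mulrDl mul1r; apply: le_trans (lenM _ _) _.
by rewrite lerD2l.
Qed.

Let pair_weight_ge0 p : 0 <= F p ^+ 2. Proof. exact: sqr_ge0. Qed.

(** W and its preimages by h^3 and h^6 are disjoint and have nearly the same
    mass; the errors are 9 * 3 * eta and 9 * 6 * eta. *)
Let wandering_mass_le eta g (W : set Z2) :
    len g <= eta -> 0 < eta -> 6 * eta <= 1 ->
    (forall n v, (3 <= n)%N -> W v -> ~ W (iter n (mulmx (SA2Z_lin g)) v)) ->
  3 * pair_mass W <= pair_mass [set v | v != 0] + 81 * eta.
Proof.
move=> lg eta0 eta1 Wdisj.
pose V n : set Z2 := [set v | W (iter n (mulmx (SA2Z_lin g)) v)].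
have VE n : V n = [set v | W (SA2Z_lin (g ^+ n)%g *m v)].
  by apply/seteqP; split=> v; rewrite /V /= SA2Z_linX.
have lX n : len (g ^+ n)%g <= n%:R * eta.
  by apply: le_trans (lenX _ _) _; rewrite ler_wpM2l.
have M3 : pair_mass W <= pair_mass (V 3) + 9 * (3 * eta).
  by rewrite VE; have [|//] := pair_mass_le W (lX 3) (len_ge0 _); lra.
have M6 : pair_mass W <= pair_mass (V 6) + 9 * (6 * eta).
  by rewrite VE; have [|//] := pair_mass_le W (lX 6) (len_ge0 _); lra.
have F1 := square_norm1 f_norm1.
have W0 v : W v -> v != 0.
  apply: contraPneq => -> W0; apply: (Wdisj 3 0) => //=.
  by rewrite !mulmx0.
have V0 n v : V n v -> v != 0.
  move=> /W0; apply: contraNneq => ->; elim: n => //= n /eqP ->.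
  by rewrite mulmx0.
have : pair_mass W + pair_mass (V 3) + pair_mass (V 6) <= pair_mass [set v | v != 0].
  rewrite /pair_mass -massU//; last by move=> p; apply: Wdisj.
  rewrite -massU//; last first.
    move=> p [Wp|V3p]; first exact: Wdisj.
    exact: (Wdisj 3 _ isT V3p).
  apply: le_mass => // p /= [[|]|]; [exact: W0|exact: (V0 3)|exact: (V0 6)].
lra.
Qed.

(** Off the origin everything is covered by W1 and the preimage of W2 by b, two
    sets that carry about a third of the nonzero mass each. *)
Let nonzero_mass_le eta gh gb (W1 W2 : set Z2) :
    len gh <= eta -> len gb <= eta -> 0 < eta -> 6 * eta <= 1 ->
    (forall v, v != 0 -> W1 v \/ W2 (SA2Z_lin gb *m v)) ->
    (forall n v, (3 <= n)%N ->
      (W1 v -> ~ W1 (iter n (mulmx (SA2Z_lin gh)) v)) /\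
      (W2 v -> ~ W2 (iter n (mulmx (SA2Z_lin gh)) v))) ->
  pair_mass [set v | v != 0] <= 189 * eta.
Proof.
move=> lh lb eta0 eta1 cover disj.
have m1 := wandering_mass_le lh eta0 eta1 (fun n v n3 => (disj n v n3).1).
have m2 := wandering_mass_le lh eta0 eta1 (fun n v n3 => (disj n v n3).2).
have [||_ m3] := pair_mass_le W2 lb; [by []|lra|].
have F1 := square_norm1 f_norm1.
have : pair_mass [set v | v != 0] <=
    pair_mass W1 + pair_mass [set v | W2 (SA2Z_lin gb *m v)].
  apply: le_trans (mass_leU _ _ _ _) => //.
  by apply: le_mass => // p /= /cover.
lra.
Qed.

(** The mass of the diagonal is the sum of f^4, and f^2 sums to 1. *)
Let diagonal_mass_le c : (forall x, f x ^+ 2 <= c) ->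
  pair_mass [set 0] <= c.
Proof.
move=> fc; have F1 := square_norm1 f_norm1.
have c0 : 0 <= c by apply: le_trans (fc 0); apply: sqr_ge0.
have bij : set_bij [set: Z2] [set p : Z2 * Z2 | p.1 - p.2 = 0] (fun x => (x, x)).
  split=> [x _|x y _ _ []//|[x y] /= /eqP]; first by rewrite /= subrr.
  by rewrite subr_eq0 => /eqP <-; exists x.
rewrite -lee_fin -massE// (@reindex_esum _ _ _ _ _ _ _ bij).
have -> : c%:E = (\esum_(x in setT) (c%:E * (f x ^+ 2)%:E))%E.
  by rewrite esumZl ?f_norm1 ?mule1// => x; rewrite lee_fin sqr_ge0.
apply: le_esum => x _; rewrite -EFinM lee_fin /F /= exprMn.
by rewrite ler_wpM2r// sqr_ge0.
Qed.

(** A word of length #|M_2(Z/6)| in S moves f by at most eta = 1/1000, so that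
    [nonzero_mass_le] leaves more than 2/3 of the mass on the diagonal. *)
Lemma no_almost_invariant_function (S : set SA2Z) e :
    group_generated_by S -> 0 < e -> 1000 * (#|'M['Z_6]_2|%:R * e) <= 1 ->
    (forall s, S s -> len s <= e) -> False.
Proof.
move=> genS e0 e1 lenS; set N := #|_|%:R in e1.
have N1 : 1 <= N by rewrite ler1n; apply/card_gt0P; exists 0.
pose eta : R := 1 / 1000.
have Ne : N * e <= eta by rewrite /eta; lra.
have eta0 : 0 < eta by rewrite /eta; lra.
have eta1 : 6 * eta <= 1 by rewrite /eta; lra.
have lift :=
  short_words_fill_quotient lin_mod6_1 lin_mod6M len1 lenM genS (ltW e0) lenS.
have [gh hE lh] := lift (MkSA2Z (MkSL2Z (introT eqP det_pingpong_h)) 0).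
have [gb bE lb] := lift (MkSA2Z (MkSL2Z (introT eqP det_pingpong_b)) 0).
have [tr3 d1 d2] := mod6_pingpong hE bE.
have [W1 [W2 [cover disj]]] := linear_pingpong R
  (eqP (SL2Z_det (SA2Z_lin gh))) (eqP (SL2Z_det (SA2Z_lin gb))) tr3 d1 d2.
have m0 := nonzero_mass_le (le_trans lh Ne) (le_trans lb Ne) eta0 eta1 cover disj.
have F1 := square_norm1 f_norm1.
have md : 1 <= pair_mass [set 0] + pair_mass [set v | v != 0].
  rewrite -(massT F1); apply: le_trans (mass_leU _ _ _ _) => //.
  apply: le_mass => // p _ /=; have [->|] := eqVneq (p.1 - p.2) 0; by [left|right].
have [x fx] : exists x, 2 / 3 < f x ^+ 2.
  apply: contrapT => H; have /diagonal_mass_le : forall x, f x ^+ 2 <= 2 / 3.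
    by move=> x; rewrite leNgt; apply/negP => fx; apply: H; exists x.
  by have := m0; rewrite /eta; lra.
have [s Ss sx] := no_fixed_point x genS.
set y := affine_act s^-1%g x.
have yx : y <> x.
  by move=> e'; move: sx; rewrite -{1}e' affine_actVK eqxx.
have sq0 z : 0 <= f z ^+ 2 by exact: sqr_ge0.
have pt z : mass (fun x => f x ^+ 2) [set z] = f z ^+ 2.
  by rewrite /mass esum_set1// lee_fin.
have fxy : f x ^+ 2 + f y ^+ 2 <= 1.
  rewrite -(massT f_norm1) -!pt -massU//; first exact: le_mass.
  by move=> z -> /esym.
have fyx : (f y - f x) ^+ 2 <= e ^+ 2.
  rewrite -lee_fin; apply: (@le_trans _ _ (len s ^+ 2)%:E).
    apply: le_trans (len_displ s).
    rewrite -(@esum_set1 _ _ x (fun z => ((f (affine_act s^-1%g z) - f z) ^+ 2)%:E)).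
      by apply: le_esum_set => // z; rewrite lee_fin sqr_ge0.
    by rewrite lee_fin sqr_ge0.
  by rewrite lee_fin lerXn2r ?nnegrE ?lenS// ltW.
have e2 : e <= 1 / 1000 by nra.
have := f_ge0 x; have := f_ge0 y => fy0 fx0.
have fx1 : f x <= 1.
  by rewrite -(ler_pXn2r (n := 2)) ?nnegrE// expr1n; have := sq0 y; lra.
have : f x - f y <= e.
  rewrite leNgt; apply/negP => h; move: fyx; apply/negP; rewrite -ltNge.
  rewrite (_ : (f y - f x) ^+ 2 = (f x - f y) ^+ 2); last by ring.
  by rewrite ltrXn2r ?nnegrE ?ltW// (lt_trans e0).
nra.
Qed.

End AlmostInvariant.

(** * Displacement of vectors in unitary representations *)

Section RealNorm.
Variables (R : realType) (H : hilbertSpace R).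
Implicit Types x y : H.

Lemma rnormE x : `|x| = (rnorm x)%:C%C.
Proof. by rewrite /rnorm RRe_real// normr_real. Qed.

Lemma rnorm_ge0 x : 0 <= rnorm x.
Proof. by rewrite -ler0c -rnormE normr_ge0. Qed.

Lemma rnorm0 : rnorm (0 : H) = 0.
Proof. by rewrite /rnorm normr0. Qed.

Lemma rnormN x : rnorm (- x) = rnorm x.
Proof. by rewrite /rnorm normrN. Qed.

Lemma ler_rnormD x y : rnorm (x + y) <= rnorm x + rnorm y.
Proof. by rewrite -lecR rmorphD /= -!rnormE ler_normD. Qed.

Lemma ler_dist_rnorm x y : `|rnorm x - rnorm y| <= rnorm (x - y).
Proof.
have tri (u v : H) : rnorm u - rnorm v <= rnorm (u - v).
  by rewrite lerBlDr; have := ler_rnormD (u - v) v; rewrite subrK.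
by rewrite ler_norml tri andbT lerNl opprB -(rnormN (x - y)) opprB tri.
Qed.

End RealNorm.

Section UnitaryRep.
Variables (R : realType) (G : groupType) (pi : unitaryRep R G).

Lemma rnorm_rep g x : rnorm (pi g x) = rnorm x.
Proof.
apply: (pexpIrn (n := 2)); rewrite ?nnegrE ?rnorm_ge0//.
apply/complexI; rewrite !rmorphXn /= -!rnormE.
by rewrite !inner_norm rep_op_inner.
Qed.

Lemma displacementM xi g h :
  rnorm (pi (g * h)%g xi - xi) <= rnorm (pi g xi - xi) + rnorm (pi h xi - xi).
Proof.
have -> : pi (g * h)%g xi - xi = (pi g xi - xi) + pi g (pi h xi - xi).
  by rewrite rep_opM linearB /= [RHS]addrC [RHS]addrA subrK.
by apply: le_trans (ler_rnormD _ _) _; rewrite rnorm_rep.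
Qed.

Lemma kappa_ge (e : R) :
    (forall S xi, group_generated_by S -> rnorm xi = 1 ->
      ~ forall g, S g -> rnorm (pi g xi - xi) <= e) ->
  (e%:E <= kappa pi)%E.
Proof.
move=> gap; apply/ereal_infP => _ [S [_ genS] <-].
apply/ereal_infP => _ [xi xi1 <-].
rewrite leNgt; apply/negP => lt_e; apply: (gap S xi genS xi1) => g Sg.
rewrite -lee_fin; apply: le_trans (ltW lt_e).
by apply: ereal_sup_ubound; exists g.
Qed.

End UnitaryRep.

(** * Representations induced from SL(2,Z) *)

Section InducedFromSL2Z.
Variables (R : realType) (sigma : unitaryRep R SL2Z) (pi : unitaryRep R SA2Z).

Definition translation (x : Z2) : SA2Z := MkSA2Z 1%g x.

Lemma SL2Z_in_SA2Z1 : (SL2Z_in_SA2Z : {multiplicative SL2Z -> SA2Z}) 1%g = 1%g.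
Proof. by []. Qed.

Lemma translation_coset g :
  g = (translation (SA2Z_trans g) * SL2Z_in_SA2Z (SA2Z_lin g))%g.
Proof.
case: g => A v; rewrite /translation /=.
rewrite [RHS]/(SA2Z_mul _ _) /SA2Z_mul /= mul1g mulmx0 addr0 //.
Qed.

(** The translations represent the cosets of SL(2,Z), and by equivariance and
    unitarity the norm of phi does not depend on the representative. *)
Lemma ind_sqnormE (phi : SA2Z -> rep_space sigma) :
    ind_equivariant SL2Z_in_SA2Z phi ->
  ind_sqnorm SL2Z_in_SA2Z phi =
    (\esum_(x in [set: Z2]) (rnorm (phi (translation x)) ^+ 2)%:E)%E.
Proof.
move=> phi_eq.
have bij : set_bij [set: Z2] (range (coset_of_image SL2Z_in_SA2Z))
    (fun x => coset_of_image SL2Z_in_SA2Z (translation x)).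
  split=> [x _|x y _ _ cosets|_ [g _ <-]]; first by exists (translation x).
    have : coset_of_image SL2Z_in_SA2Z (translation y) (translation x).
      by rewrite -cosets; exists 1%g => //; rewrite SL2Z_in_SA2Z1 mulg1.
    move=> [k _ /(congr1 SA2Z_trans)].
    by rewrite /= mulmx0 addr0.
  exists (SA2Z_trans g) => //; apply/seteqP; split=> _ [k _ <-].
    exists ((SA2Z_lin g)^-1 * k)%g => //.
    by rewrite {1}[g]translation_coset -mulgA -gmulfM mulVKg.
  exists (SA2Z_lin g * k)%g => //.
  by rewrite gmulfM mulgA -translation_coset.
have val x : rnorm (phi (xget 1%g (coset_of_image SL2Z_in_SA2Z (translation x)))) =
    rnorm (phi (translation x)).
  set C := coset_of_image _ _.
  have [k _ <-] : C (xget 1%g C).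
    apply: (@xgetPex _ 1%g C); exists (translation x); exists 1%g => //.
    by rewrite SL2Z_in_SA2Z1 mulg1.
  by rewrite phi_eq rnorm_rep.
rewrite /ind_sqnorm (@reindex_esum _ _ _ _ _ _ _ bij).
by apply: eq_esum => x _; rewrite val.
Qed.

Hypothesis induced : is_induced_from SL2Z_in_SA2Z sigma pi.

(** The function f is the pointwise norm of U xi along the translations: sigma
    disappears from its transformation law, and the reverse triangle inequality
    bounds its displacement by that of xi. *)
Lemma induced_no_almost_invariant (S : set SA2Z) xi e :
    group_generated_by S -> rnorm xi = 1 -> 0 < e ->
    1000 * (#|'M['Z_6]_2|%:R * e) <= 1 ->
  ~ forall g, S g -> rnorm (pi g xi - xi) <= e.
Proof.
move=> genS xi1 e0 e1; have [U [Ueq Unorm _ Upi]] := induced.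
have normE x : (\esum_(v in [set: Z2]) (rnorm (U (translation v) x) ^+ 2)%:E)%E =
    (rnorm x ^+ 2)%:E by rewrite -Unorm ind_sqnormE.
pose f v := rnorm (U (translation v) xi).
have fact g v : f (affine_act g^-1%g v) = rnorm (U (translation v) (pi g xi)).
  rewrite Upi [(g^-1 * _)%g]translation_coset Ueq rnorm_rep /f.
  by congr (rnorm (U (translation _) _)); rewrite /affine_act /= addrC.
apply: (@no_almost_invariant_function R f (fun g => rnorm (pi g xi - xi))
  _ _ _ _ _ _ S e) => //.
- by move=> v; apply: rnorm_ge0.
- by rewrite normE xi1 expr1n.
- by rewrite rep_op1 subrr rnorm0.
- exact: displacementM.
- move=> g; rewrite -normE; apply: le_esum => v _; rewrite lee_fin fact linearB /=.
  by rewrite -real_normK ?num_real// lerXn2r ?nnegrE ?rnorm_ge0// ler_dist_rnorm.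
- by move=> g; apply: rnorm_ge0.
Qed.

End InducedFromSL2Z.

Local Open Scope ereal_scope.

Theorem corollary1p5 (R : realType) :
  0 < ereal_inf [set k : \bar R | exists2 pi : unitaryRep R SA2Z,
                   irrep_induced_from_SL2Z pi & k = kappa pi].
Proof.
have [N NE N0] : exists2 N : R, N = (#|'M['Z_6]_2|%:R)%R & (0 < N)%R.
  by exists (#|'M['Z_6]_2|%:R)%R => //; rewrite ltr0n; apply/card_gt0P; exists 0%R.
pose e : R := (N^-1 / 1000)%R.
have e0 : (0 < e)%R by have := N0; rewrite -invr_gt0 /e; lra.
apply: (@lt_le_trans _ _ e%:E); first by rewrite lte_fin.
apply/ereal_infP => _ [pi [_ [sigma [_ ind]]] ->].
apply: kappa_ge => S xi genS xi1.
apply: (induced_no_almost_invariant ind genS xi1 e0).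
have Ne : (N * e = 1000^-1)%R by rewrite /e mulrA mulfV ?lt0r_neq0// mul1r.
by rewrite -NE Ne; lra.
Qed.
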